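(* Let $G$ be a graph. Then the end space $\Omega(G)$ is Lindelöf if, and only if, for every finite set $F\subseteq V(G)$, at most countably many connected components of $G\setminus F$ contain rays.
   Context: A graph is a pair $G=(V(G),E(G))$ with $V(G)$ an arbitrary set and $E(G)\subseteq [V(G)]^2$ (two-element subsets). A ray in $G$ is an injective sequence of vertices $(v_0,v_1,\dots)$ with $\{v_i,v_{i+1}\}\in E(G)$ for all $i$; a tail of it is $(v_n,v_{n+1},\dots)$ for some $n$. For finite $F\subseteq V(G)$, $G\setminus F$ is the subgraph induced on $V(G)\setminus F$; a connected component is a maximal connected subgraph. Two rays of $G$ are equivalent if for every finite $F\subseteq V(G)$ they have tails lying in the same connected component of $G\setminus F$. An end is an equivalence class of rays, and $\Omega(G)$ is the set of ends. For an end $\epsilon$ and finite $F\subseteq V(G)$, $G(\epsilon,F)$ is the unique connected component of $G\setminus F$ containing a tail of every ray of $\epsilon$, and $\Omega(\epsilon,F)$ is the set of all ends having a ray contained in $G(\epsilon,F)$. A set $U\subseteq\Omega(G)$ is open if for every $\epsilon\in U$ there is a finite $F\subseteq V(G)$ with $\Omega(\epsilon,F)\subseteq U$; this topologizes $\Omega(G)$, the end space of $G$. A space is Lindelöf if every open cover has a countable subcover. *)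

(* Defs.v *)
From HB Require Import structures.
From mathcomp Require Import all_boot all_order.
From mathcomp Require Import all_classical topology.

Set Implicit Arguments.
Unset Strict Implicit.
Unset Printing Implicit Defensive.

Local Open Scope classical_set_scope.

Definition two_subsets (T : Type) (V : set T) : set (set T) :=
  [set e | exists x y, [/\ V x, V y, x <> y & e = [set x; y]]].

(* The vertices form a set in an ambient type [T], so that a subgraph of a     *)
(* [graph T] is again a [graph T].                                             *)
Record graph (T : Type) := Graph {
  vert : set T;
  edge : set (set T);
  edge_two_subsets : edge `<=` two_subsets vert
}.

HB.instance Definition _ T := gen_eqMixin (graph T).
HB.instance Definition _ T := gen_choiceMixin (graph T).

Definition adj T (G : graph T) (x y : T) : Prop := edge G [set x; y].

Definition subgraph T (H G : graph T) : Prop :=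
  vert H `<=` vert G /\ edge H `<=` edge G.

Lemma induced_subproof T (G : graph T) (A : set T) :
  [set e | edge G e /\ e `<=` A] `<=` two_subsets (vert G `&` A).
Proof.
move=> e [/edge_two_subsets [x [y [Gx Gy xy ->]]] eA].
by exists x, y; split => //; split => //; apply: eA; [left|right].
Qed.

Definition induced T (G : graph T) (A : set T) : graph T :=
  Graph (@induced_subproof T G A).

Definition delete T (G : graph T) (F : set T) : graph T := induced G (~` F).

Definition walk_between T (G : graph T) (x y : T) : Prop :=
  exists2 p : seq T, path (fun u v => `[< adj G u v >]) x p & last x p = y.

(* The empty graph does not count as connected.                                *)
Definition connected_graph T (G : graph T) : Prop :=
  vert G !=set0 /\
  forall x y, vert G x -> vert G y -> walk_between G x y.

Definition is_component T (G C : graph T) : Prop :=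
  [/\ subgraph C G, connected_graph C &
      forall D, subgraph D G -> connected_graph D -> subgraph C D -> D = C].

Definition is_ray T (G : graph T) (r : nat -> T) : Prop :=
  [/\ injective r, forall n, vert G (r n) & forall n, adj G (r n) (r n.+1)].

Definition tail T (n : nat) (r : nat -> T) : nat -> T := fun i => r (n + i)%N.

Definition ray_equiv T (G : graph T) (r s : nat -> T) : Prop :=
  forall F : set T, finite_set F -> F `<=` vert G ->
  exists C m n, [/\ is_component (delete G F) C,
                    is_ray C (tail m r) & is_ray C (tail n s)].

Definition ends T (G : graph T) : set (set (nat -> T)) :=
  [set [set s | is_ray G s /\ ray_equiv G r s] | r in is_ray G].

(* A separate constant, so that the topology declared on it below does not     *)
(* compete with the one that a type of functions inherits from the library.    *)
Definition end_space T (G : graph T) : Type := set_type (ends G).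

Definition rays_of T (G : graph T) (e : end_space G) : set (nat -> T) := sval e.

Definition is_end_comp T (G : graph T) (e : end_space G) (F : set T)
    (C : graph T) : Prop :=
  is_component (delete G F) C /\
  forall r, rays_of e r -> exists n, is_ray C (tail n r).

(* G(e, F); for finite [F] the choice is the unique possible one, see          *)
(* [end_compP] and [end_comp_unique]. The default [G] is only used otherwise.  *)
Definition end_comp T (G : graph T) (e : end_space G) (F : set T) : graph T :=
  xget G [set C | is_end_comp e F C].

Definition end_nbhd T (G : graph T) (e : end_space G) (F : set T) :
    set (end_space G) :=
  [set w | exists2 r, rays_of w r & is_ray (end_comp e F) r].

Definition end_open T (G : graph T) (U : set (end_space G)) : Prop :=
  forall e, U e ->
  exists F, [/\ finite_set F, F `<=` vert G & end_nbhd e F `<=` U].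

Section graph_lemmas.
Variable T : Type.
Implicit Types (G H C D : graph T) (r s : nat -> T) (F : set T).

Lemma graph_eq G H : vert G = vert H -> edge G = edge H -> G = H.
Proof.
case: G H => [V E p] [V' E' q] /= VV EE; subst V' E'.
by rewrite (Prop_irrelevance p q).
Qed.

Lemma subgraph_refl G : subgraph G G.
Proof. by split. Qed.

Lemma subgraph_trans G H C : subgraph G H -> subgraph H C -> subgraph G C.
Proof.
by move=> [a b] [c d]; split=> x; [move/a/c | move/b/d].
Qed.

Lemma adj_sym G x y : adj G x y -> adj G y x.
Proof. by rewrite /adj setUC. Qed.

Lemma adj_vert G x y : adj G x y -> vert G x /\ vert G y.
Proof.
move=> /edge_two_subsets [u [v [Gu Gv _ e]]].
have sub z : [set x; y] z -> vert G z by rewrite e => -[->|->].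
by split; apply: sub; [left|right].
Qed.

Lemma walk_refl G x : walk_between G x x.
Proof. by exists [::]. Qed.

Lemma walk_trans G x y z :
  walk_between G x y -> walk_between G y z -> walk_between G x z.
Proof.
move=> [p pp <-] [q qq <-]; exists (p ++ q); last by rewrite last_cat.
by rewrite cat_path pp.
Qed.

Lemma walk_adj G x y : adj G x y -> walk_between G x y.
Proof. by move=> xy; exists [:: y] => //=; rewrite andbT; apply/asboolP. Qed.

Lemma walk_sym G x y : walk_between G x y -> walk_between G y x.
Proof.
move=> [p]; elim: p x => [|z p IH] x /=.
  by move=> _ ->; exact: walk_refl.
move=> /andP[/asboolP xz zp] lst.
by apply: walk_trans (IH z zp lst) _; apply: walk_adj; exact: adj_sym.
Qed.

Lemma walk_sub H G x y :
  subgraph H G -> walk_between H x y -> walk_between G x y.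
Proof.
move=> [_ HG] [p hp lp]; exists p => //.
by apply: sub_path hp => u v /asboolP /HG ?; apply/asboolP.
Qed.

Definition comp_of G x : graph T := induced G (walk_between G x).

Lemma comp_of_sub G x : subgraph (comp_of G x) G.
Proof. by split=> [y []|e []]. Qed.

Lemma comp_of_walk G x y : walk_between G x y -> walk_between (comp_of G x) x y.
Proof.
move=> [p]; elim/last_ind: p y => [|p z IH] y /=.
  by move=> _ <-; exact: walk_refl.
rewrite rcons_path last_rcons => /andP[xp /asboolP az] <-.
apply: walk_trans (IH _ xp erefl) _; apply: walk_adj.
have wl : walk_between G x (last x p) by exists p.
split=> // u [->|->] //.
exact: walk_trans wl (walk_adj az).
Qed.

Lemma comp_of_connected G x : vert G x -> connected_graph (comp_of G x).
Proof.
move=> Gx; split; first by exists x; split=> //; exact: walk_refl.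
move=> y z [_ /comp_of_walk xy] [_ /comp_of_walk xz].
exact: walk_trans (walk_sym xy) xz.
Qed.

Lemma connected_sub_comp_of G D x : subgraph D G -> connected_graph D ->
  vert D x -> subgraph D (comp_of G x).
Proof.
move=> DG [_ cD] Dx.
have DR y : vert D y -> walk_between G x y.
  by move=> Dy; apply: walk_sub DG _; exact: cD.
split=> [y Dy|e De]; first by split; [exact: DG.1 | exact: DR].
split; first exact: DG.2.
by have [u [v [Du Dv _ ->]]] := edge_two_subsets De => w [->|->]; exact: DR.
Qed.

Lemma comp_of_component G x : vert G x -> is_component G (comp_of G x).
Proof.
move=> Gx; split; [exact: comp_of_sub | exact: comp_of_connected|].
move=> D DG cD CD.
have Dx : vert D x by apply: CD.1; split=> //; exact: walk_refl.
have DC := connected_sub_comp_of DG cD Dx.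
by apply: graph_eq; apply/seteqP; split; [exact: DC.1|exact: CD.1|exact: DC.2|
  exact: CD.2].
Qed.

Lemma componentE G C x : is_component G C -> vert C x -> C = comp_of G x.
Proof.
move=> [CG cC maxC] Cx; apply/esym/maxC; first exact: comp_of_sub.
  by apply: comp_of_connected; exact: CG.1.
exact: connected_sub_comp_of.
Qed.

Lemma component_connected_sub G C D x : is_component G C -> subgraph D G ->
  connected_graph D -> vert C x -> vert D x -> subgraph D C.
Proof.
by move=> cC DG cD Cx Dx; rewrite (componentE cC Cx); exact: connected_sub_comp_of.
Qed.

Lemma is_ray_tail G r n : is_ray G r -> is_ray G (tail n r).
Proof.
move=> [ir vr ar]; split=> [i j /ir /addnI //|i|i]; first exact: vr.
by rewrite /tail addnS; exact: ar.
Qed.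

Lemma tailD r m n : tail n (tail m r) = tail (m + n)%N r.
Proof. by apply/funext => i; rewrite /tail addnA. Qed.

Lemma component_ray_eq G C D r m n : is_component G C -> is_component G D ->
  is_ray C (tail m r) -> is_ray D (tail n r) -> C = D.
Proof.
move=> cC cD [_ vC _] [_ vD _].
have Cx := vC n; have Dx := vD m; rewrite /tail addnC in Dx.
by rewrite (componentE cC Cx) (componentE cD Dx).
Qed.

Lemma component_of_ray G F r : finite_set F -> is_ray G r ->
  exists C n, is_component (delete G F) C /\ is_ray C (tail n r).
Proof.
move=> finF [ir vr ar].
have finN : finite_set (r @^-1` F).
  by apply: finite_preimage => // i j _ _; exact: ir.
have [n nF] : exists n, forall i, ~ F (r (n + i)%N).
  move: finN => /finite_seqP [k hk].
  exists (\max_(i <- k) i).+1 => i Fi.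
  have : ((\max_(i <- k) i).+1 + i)%N \in k.
    have : (r @^-1` F) ((\max_(i <- k) i).+1 + i)%N by [].
    by rewrite hk.
  move=> jk; have := @leq_bigmax_seq _ k xpredT id _ jk isT.
  by rewrite addSn leqNgt ltnS leq_addr.
exists (comp_of (delete G F) (r n)), n.
have vn i : vert (delete G F) (tail n r i) by split; [exact: vr | exact: nF].
have an i : adj (delete G F) (tail n r i) (tail n r i.+1).
  split; first by rewrite /tail addnS; exact: ar.
  by move=> z [->|->]; exact: nF.
have wn i : walk_between (delete G F) (r n) (tail n r i).
  elim: i => [|i IH]; first by rewrite /tail addn0; exact: walk_refl.
  exact: walk_trans IH (walk_adj (an i)).
split.
  by apply: comp_of_component; have := vn 0%N; rewrite /tail addn0.
split=> [i j /ir /addnI //|i|i]; first by split; [exact: vn | exact: wn].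
by split; [exact: an | move=> z [->|->]; exact: wn].
Qed.

Lemma rays_of_rayP G (e : end_space G) r : rays_of e r -> is_ray G r.
Proof. by case: e => e /= eG; have /set_mem [s _ <-] := eG => -[]. Qed.

Lemma rays_of_nonempty G (e : end_space G) : rays_of e !=set0.
Proof.
case: e => e eG; have /set_mem [r rG re] := eG.
exists r; rewrite /rays_of /= -re; split=> // F finF FG.
by have [C [n [cC rC]]] := component_of_ray finF rG; exists C, n, n.
Qed.

Lemma end_comp_unique G (e : end_space G) F C D :
  is_end_comp e F C -> is_end_comp e F D -> C = D.
Proof.
move=> [cC rC] [cD rD]; have [r er] := rays_of_nonempty e.
have [m rm] := rC r er; have [n rn] := rD r er.
exact: component_ray_eq cC cD rm rn.
Qed.

Lemma end_compP G (e : end_space G) F : finite_set F -> F `<=` vert G ->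
  is_end_comp e F (end_comp e F).
Proof.
move=> finF FG; rewrite /end_comp.
suff [C hC] : exists C, is_end_comp e F C by apply: (xgetI _ (x := C)).
case: e => e eG; have /set_mem [r rG re] := eG.
have [C [n [cC rC]]] := component_of_ray finF rG.
exists C; split=> // s; rewrite /rays_of /= -re => -[sG rs].
have [D [k [l [cD rD sD]]]] := rs F finF FG.
by exists l; rewrite (component_ray_eq cC cD rC rD).
Qed.

Lemma end_comp_sub G (e : end_space G) F F' : finite_set F -> finite_set F' ->
  F' `<=` vert G -> F `<=` F' -> subgraph (end_comp e F') (end_comp e F).
Proof.
move=> finF finF' F'G FF'.
have [cC rC] := end_compP e finF (subset_trans FF' F'G).
have [cC' rC'] := end_compP e finF' F'G.
have [r er] := rays_of_nonempty e.
have [m [_ rm _]] := rC r er; have [n [_ rn _]] := rC' r er.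
have [sC' conC' _] := cC'.
have Cx := rm n; have C'x := rn m; rewrite /tail addnC in C'x.
apply: (component_connected_sub cC _ conC' Cx C'x).
apply: subgraph_trans sC' _; split=> [x [Gx nF]|f [Gf fF]]; split=> //.
  by move=> /FF'.
by move=> x /fF nF /FF'.
Qed.

Lemma is_ray_sub H G r : subgraph H G -> is_ray H r -> is_ray G r.
Proof.
by move=> [v a] [ir vr ar]; split=> // n; [exact/v/vr | exact/a/ar].
Qed.

Lemma end_openT G : end_open (@setT (end_space G)).
Proof. by move=> e _; exists set0; split. Qed.

Lemma end_openI G : setI_closed (@end_open T G).
Proof.
move=> U V oU oV e [Ue Ve].
have [F [finF FG FU]] := oU e Ue; have [F' [finF' F'G F'V]] := oV e Ve.
have FFG : F `|` F' `<=` vert G by move=> x [/FG|/F'G].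
have finFF : finite_set (F `|` F') by rewrite finite_setU.
exists (F `|` F'); split=> // w [r wr rC]; split.
  by apply: FU; exists r => //; apply: is_ray_sub rC; exact: end_comp_sub.
by apply: F'V; exists r => //; apply: is_ray_sub rC; exact: end_comp_sub.
Qed.

Lemma end_open_bigU G (I : Type) (f : I -> set (end_space G)) :
  (forall i, end_open (f i)) -> end_open (\bigcup_i f i).
Proof.
move=> of_ e [i _ fe]; have [F [finF FG Ff]] := of_ i e fe.
by exists F; split=> // w /Ff ?; exists i.
Qed.

End graph_lemmas.

HB.instance Definition _ T (G : graph T) := gen_eqMixin (end_space G).
HB.instance Definition _ T (G : graph T) := gen_choiceMixin (end_space G).
HB.instance Definition _ T (G : graph T) :=
  isOpenTopological.Build (end_space G)
    (@end_openT T G) (@end_openI T G) (@end_open_bigU T G).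

Lemma end_openE T (G : graph T) : @open (end_space G) = @end_open T G.
Proof. by []. Qed.

Definition lindelof (X : topologicalType) : Prop :=
  forall O : set (set X), O `<=` open -> \bigcup_(U in O) U = setT ->
  exists2 O' : set (set X), O' `<=` O &
    countable O' /\ \bigcup_(U in O') U = setT.

(* Main.v *)
Require Import Defs.
From mathcomp Require Import all_boot all_order.
From mathcomp Require Import all_classical topology.

Local Open Scope classical_set_scope.

(** If [Omega(G)] is Lindelof and [F] is finite, the ends living in the various
    components of [G - F] form a partition of [Omega(G)] into open sets, so
    only countably many of these components contain rays
    ([lindelof_countable_components]).

    For the converse, fix an open cover [O] and call a set of vertices large if
    no countable part of [O] covers the ends having a ray in it.  A region is a
    connected set [C] whose boundary [N(C)] is finite.  Since deleting finitely
    many vertices from a large region leaves only countably many components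
    with rays, one of them is again large ([large_split]).  Assume that the
    whole graph is large.  A ray [v_0 v_1 ...] and large regions
    [C_0 > C_1 > ...] are then built in a depth-first way: [v_(n+1)] is a
    vertex of [C_n] adjacent to [v_n], and [C_(n+1)] is a component of
    [C_n - v_(n+1)].  Hence [v_n] always has a neighbour in [C_n], and [N(C_n)]
    lies on the ray.

    The descent is steered by a minimality condition.  Repeatedly, from the
    current [C_i], one picks a large region [D] properly contained in [C_i]
    with [|N(D)|] least possible, and then continues depth-first until some
    [C_j] is contained in [D] ([descend], [jump_exists]).

    Let [e] be the end of the ray, [U] a member of [O] containing [e], and [F]
    a finite set such that [U] contains all ends living in [E = G(e, F)].  Then
    [E] contains all [v_i] with [i >= m], for some [m].  For [n >= m] the set
    [C_n - F] contains a large region; it is not inside [E], because the ends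
    in [E] are covered by [U] alone, so it is disjoint from [E] and not
    adjacent to it.  Its boundary therefore lies in
    [F] together with [v_0, ..., v_(m-1)], whose size [p] does not depend on
    [n].  By minimality, the chosen regions [D] eventually all satisfy
    [|N(D)| <= p].  This forces the intersection [K] of all [C_n] to be empty:
    otherwise each [C_n], being connected, contains a vertex outside [K]
    adjacent to [K]; this gives [p + 1] distinct vertices outside [K] with a
    neighbour in [K], and all of them are in [N(D)] when [D] is small enough
    ([small_boundary_meet_empty]).  So [C_n] is disjoint from [F] for large
    [n]; being connected and containing a tail of the ray, it is then contained
    in [E], and cannot be large ([no_descent]). *)

Set Implicit Arguments.
Unset Strict Implicit.
Unset Printing Implicit Defensive.

(** * Ends and components *)

Section ends_and_components.
Variables (T : Type) (G : graph T).
Implicit Types (w : end_space G) (r : nat -> T) (F : set T).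

Lemma rays_of_tail w r n : rays_of w r -> rays_of w (tail n r).
Proof.
case: w => e eG; have /set_mem [r0 r0G re] := eG; rewrite /rays_of /= -re.
move=> [rG rr]; split; first exact: is_ray_tail.
move=> F finF FG; have [C [k [l [cC r0C rC]]]] := rr F finF FG.
by exists C, k, l; split=> //; rewrite tailD addnC -tailD; exact: is_ray_tail.
Qed.

Lemma end_of_ray r : is_ray G r -> exists w, rays_of w r.
Proof.
move=> rG; have eG : ends G [set s | is_ray G s /\ ray_equiv G r s] by exists r.
exists (exist (fun e => e \in ends G) _ (mem_set eG)); split=> // F finF FG.
by have [C [n [cC rC]]] := component_of_ray finF rG; exists C, n, n.
Qed.

Lemma end_comp_eq w F C r : finite_set F -> F `<=` vert G ->
  is_component (delete G F) C -> rays_of w r -> is_ray C r -> C = end_comp w F.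
Proof.
move=> finF FG cC wr rC; have [cD rD] := end_compP w finF FG.
have [n rn] := rD r wr.
exact: (component_ray_eq (m := 0) cC cD _ rn).
Qed.

Lemma component_adj (H C : graph T) x y :
  is_component H C -> vert C x -> adj H x y -> vert C y.
Proof.
move=> cC Cx xy; rewrite (componentE cC Cx).
by split; [case: (adj_vert xy) | exact: walk_adj].
Qed.

Lemma component_ray (H C : graph T) r : is_component H C -> is_ray H r ->
  (forall n, vert C (r n)) -> is_ray C r.
Proof.
move=> cC [ir vr ar] Cr; split=> // n.
move: (Cr n) (Cr n.+1); rewrite (componentE cC (Cr 0)) => -[_ w1] [_ w2].
by split; [exact: ar | move=> z [->|->]].
Qed.

Lemma adj_delete F x y :
  adj G x y -> ~ F x -> ~ F y -> adj (delete G F) x y.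
Proof. by move=> xy Fx Fy; split=> // z [->|->]. Qed.

End ends_and_components.

(** The sets of ends [O C] are disjoint and nonempty, so a subcover omits none
    of them. *)
Lemma lindelof_countable_components (T : Type) (G : graph T) (F : set T) :
  lindelof (end_space G) -> finite_set F -> F `<=` vert G ->
  countable [set C : graph T |
    is_component (delete G F) C /\ exists r : nat -> T, is_ray C r].
Proof.
move=> linG finF FG; set CC := [set C | _].
pose O C := [set w : end_space G | exists2 r, rays_of w r & is_ray C r].
have Oinj C D w : CC C -> CC D -> O C w -> O D w -> C = D.
  move=> [cC _] [cD _] [r wr rC] [s ws sD].
  by rewrite (end_comp_eq finF FG cC wr rC) (end_comp_eq finF FG cD ws sD).
have sub U : (O @` CC) U -> open U.
  move=> [C [cC _] <-]; rewrite end_openE => w [r wr rC]; exists F; split=> //.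
  by rewrite /end_nbhd -(end_comp_eq finF FG cC wr rC).
have cov : \bigcup_(U in O @` CC) U = setT.
  apply/seteqP; split=> // w _.
  have [r wr] := rays_of_nonempty w.
  have [C [n [cC rC]]] := component_of_ray finF (rays_of_rayP wr).
  exists (O C); first by exists C => //; split=> //; exists (tail n r).
  by exists (tail n r) => //; exact: rays_of_tail.
have [O' O'O [cO' covO']] := linG _ sub cov.
pose g U := xget G [set C | CC C /\ U = O C].
(* [g] recovers a component from its set of ends. *)
have CCg : CC `<=` g @` O'.
  move=> C CCC; have [cC [r rC]] := CCC.
  have CG : subgraph C G.
    by case: cC => CH _ _; apply: subgraph_trans CH _; split=> x [].
  have [w wr] := end_of_ray (is_ray_sub CG rC).
  have [U O'U Uw] : (\bigcup_(U in O') U) w by rewrite covO'.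
  have [D CCD DU] := O'O _ O'U.
  have CU : U = O C by rewrite -DU (Oinj C D w) // ?DU //; exists r.
  exists U => //; rewrite /g.
  have [CCE UE] : CC (xget G [set C | CC C /\ U = O C]) /\
      U = O (xget G [set C | CC C /\ U = O C]).
    by apply: (xgetI G (x := C) (P := [set C | CC C /\ U = O C])).
  apply: (Oinj _ _ w) => //; first by rewrite -UE.
  by exists r.
apply: sub_countable (subset_card_le CCg) _.
exact: sub_countable (card_image_le _ _) cO'.
Qed.

(** * Regions *)

Section regions.
Variables (T : choiceType) (G : graph T).
Implicit Types (C D E : set T) (s t : seq T) (u v w : T).

(** Restricting to [C] allows [s] to record only that part of the boundary of a
    target region which is still ahead when the search has descended to
    [C]. *)
Definition boundary_in C s D :=
  forall u w, D u -> adj G u w -> C w -> D w \/ w \in s.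

Definition separates s D :=
  (forall x, x \in s -> ~ D x) /\ boundary_in setT s D.

Definition region D :=
  [/\ D `<=` vert G, connected_graph (induced G D) & exists s, separates s D].

(** Walks enter the proofs mostly through this form of connectedness. *)
Lemma connected_exit C (P : set T) x y : connected_graph (induced G C) ->
  C `<=` vert G -> C x -> P x -> C y -> ~ P y ->
  exists u w, [/\ C u, C w, adj G u w, P u & ~ P w].
Proof.
move=> [_ cC] CG Cx Px Cy nPy.
have [||p pp lp] := cC x y; [by split; [exact: CG|]..|].
elim: p x Cx Px pp lp => [|z p IH] x Cx Px /=.
  by move=> _ xy; case: nPy; rewrite -xy.
move=> /andP[/asboolP [xz sC] pp] lp.
have Cz : C z by apply: sC; right.
have [Pz|nPz] := pselect (P z); first exact: IH pp lp.
by exists x, z.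
Qed.

Lemma connected_absorb C D s : connected_graph (induced G C) -> C `<=` vert G ->
  D `<=` C -> D !=set0 -> boundary_in C s D -> (forall x, x \in s -> ~ C x) ->
  D = C.
Proof.
move=> cC CG DC [d Dd] bD sC; apply/seteqP; split=> // y Cy.
apply: contrapT => nDy.
have [u [w [Cu Cw uw Du nDw]]] := connected_exit cC CG (DC _ Dd) Dd Cy nDy.
by have [//|/sC] := bD u w Du uw Cw.
Qed.

Lemma region_nonempty D : region D -> D !=set0.
Proof. by move=> [_ [[x [_ Dx]] _] _]; exists x. Qed.

Lemma finite_vert_seq s : finite_set ([set` s] `&` vert G).
Proof. by apply: finite_setIl; apply/finite_seqP; exists s. Qed.

Lemma component_region s (c : graph T) :
  is_component (delete G ([set` s] `&` vert G)) c ->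
  region (vert c) /\ separates s (vert c).
Proof.
move=> cc; have [[cV cE] [c0 conc] _] := cc.
have cG : vert c `<=` vert G by move=> x /cV [].
have ns x : x \in s -> ~ vert c x.
  by move=> xs cx; have [Gx] := cV _ cx; apply.
have sc : separates s (vert c).
  split=> // u w cu uw _; have [|ws] := boolP (w \in s); [by right|left].
  apply: (component_adj cc cu); apply: adj_delete => //.
    by move=> [us _]; case: (ns u).
  by move=> [ws' _]; rewrite /= ws' in ws.
split=> //; split=> //; last by exists s.
split; first by have [x cx] := c0; exists x; split=> //; exact: cG.
move=> x y [_ cx] [_ cy]; apply: walk_sub (conc x y cx cy).
split=> [z cz|e ce]; first by split=> //; exact: cG.
split; first by have [] := cE _ ce.
by have [a [b [ca cb _ ->]]] := edge_two_subsets ce => z [->|->].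
Qed.

End regions.

(** * Large regions *)

Section large_regions.
Variables (T : choiceType) (G : graph T) (O : set (set (end_space G))).
Implicit Types (C D E : set T) (s t : seq T) (u v w : T).

Definition ends_in D :=
  [set e : end_space G | exists2 r, rays_of e r & forall n, D (r n)].

Definition large D :=
  ~ exists2 O', O' `<=` O & countable O' /\ ends_in D `<=` \bigcup_(U in O') U.

Lemma large_sub C D : D `<=` C -> large D -> large C.
Proof.
move=> DC lD [O' O'O [cO' sub]]; apply: lD; exists O' => //; split=> //.
by move=> e [r er Dr]; apply: sub; exists r => // n; exact: DC.
Qed.

Lemma not_large_in_nbhd e F (U : set (end_space G)) D : O U -> finite_set F ->
  F `<=` vert G -> end_nbhd e F `<=` U -> D `<=` vert (end_comp e F) ->
  ~ large D.
Proof.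
move=> OU finF FG FU DE lD; apply: lD; exists [set U]; first by move=> _ ->.
split=> [|x [r xr Dr]]; first exact: countable1.
exists U => //; apply: FU; exists r => //.
have [cE _] := end_compP e finF FG.
have rE n : vert (end_comp e F) (r n) by exact: DE.
apply: (component_ray cE) => //.
have [ir vr ar] := rays_of_rayP xr.
have nF n : ~ F (r n).
  by have [[sub _] _ _] := cE; have [] := sub _ (rE n).
by split=> // n; [split=> //; exact: nF | exact: adj_delete].
Qed.

Hypothesis countable_comps : forall F : set T, finite_set F -> F `<=` vert G ->
  countable [set C : graph T |
    is_component (delete G F) C /\ exists r : nat -> T, is_ray C r].

(** A ray in [C] has a tail in a component of [G - (s ++ t)] inside [C], and
    there are countably many such components; if all were small, the union of
    their countable subcovers would be a countable subcover for [C]. *)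
Lemma large_split C s t : C `<=` vert G -> separates G s C -> large C ->
  exists E, [/\ E `<=` C, region G E, separates G (s ++ t) E & large E].
Proof.
move=> CG [_ bC] lC; apply: contrapT => noE; apply: lC.
set F := [set` s ++ t] `&` vert G.
have finF : finite_set F by exact: finite_vert_seq.
have FG : F `<=` vert G by move=> x [].
set CC := [set C : graph T |
  is_component (delete G F) C /\ exists r, is_ray C r].
have cCC : countable CC by exact: countable_comps.
have small c : exists O', [/\ O' `<=` O, countable O' &
    CC c -> vert c `<=` C -> ends_in (vert c) `<=` \bigcup_(U in O') U].
  have [[CCc cC]|no] := pselect (CC c /\ vert c `<=` C); last first.
    by exists set0; split=> // CCc cC; case: no.
  apply: contrapT => noO'; apply: noE; exists (vert c).
  have [rc sc] := component_region CCc.1.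
  by split=> // -[O' O'O [cO' sub]]; apply: noO'; exists O'.
have [g gP] := choice small.
exists (\bigcup_(c in CC) g c).
  by move=> U [c _ gU]; case: (gP c) => + _ _; exact.
split; first by apply: bigcup_countable => // c _; case: (gP c).
move=> e [r er Cr].
have rG := rays_of_rayP er.
have [c [n [cc rc]]] := component_of_ray finF rG.
have CCc : CC c by split=> //; exists (tail n r).
have cC : vert c `<=` C.
  move=> x cx; apply: contrapT => nCx.
  have [[cG ccon _] [sc _]] := component_region cc.
  have [_ /(_ 0) r0 _] := rc.
  have [u [w [cu cw uw Cu nCw]]] := connected_exit ccon cG r0 (Cr _) cx nCx.
  have [//|ws] := bC u w Cu uw I.
  by apply: (sc w) => //; rewrite mem_cat ws.
have [_ _ /(_ CCc cC e)] := gP c.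
case; last by move=> U gU Ue; exists U => //; exists c.
by exists (tail n r); [exact: rays_of_tail | case: rc].
Qed.

Definition large_region D := region G D /\ large D.

(** * Depth-first descent *)

(** A pair [(v, C)] is the state of the depth-first search: [v] is the last
    vertex visited and [C] the component in which the search continues. *)
Definition front (x : T * set T) :=
  [/\ large_region x.2, ~ x.2 x.1 & exists2 u, x.2 u & adj G x.1 u].

Definition step (x y : T * set T) :=
  [/\ front y, adj G x.1 y.1, x.2 y.1, y.2 `<=` x.2 &
      boundary_in G x.2 [:: y.1] y.2].

(** One move of the search towards a target [D].  The vertex visited may itself
    belong to [D]; the target is then replaced by a large region [D'] in
    [D - v], and the search continues in the component [C'] of [C - v]
    containing [D'].  The part of the boundary of the target that is still
    ahead does not grow, since the only new boundary vertex is [v]. *)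
Lemma delete_vertex C D v : region G C -> C v -> large_region D -> D `<=` C ->
  exists C' D', [/\ front (v, C'), C' `<=` C, boundary_in G C [:: v] C',
    large_region D' & D' `<=` D] /\
    (D' `<=` C' /\ forall s, boundary_in G C s D -> boundary_in G C' s D').
Proof.
move=> [CG conC [sC sepC]] Cv [[DG conD [s sepD]] lD] DC.
have [D' [D'D rD' sepD' lD']] := large_split [:: v] DG sepD lD.
have nD'v : ~ D' v by apply: sepD'.1; rewrite mem_cat inE eqxx orbT.
have [d D'd] := region_nonempty rD'.
pose H := induced G (C `&` ~` [set v]).
have vH x : C x -> x <> v -> vert H x by move=> Cx xv; split=> //; exact: CG.
have Hd : vert H d by apply: vH; [exact/DC/D'D | move=> dv; rewrite dv in D'd].
pose C' := vert (comp_of H d).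
have cc := comp_of_component Hd.
have C'C : C' `<=` C by move=> x [[_ []]].
have nC'v : ~ C' v by move=> [[_ [_ nvv]] _]; exact: nvv.
have bC' : boundary_in G C [:: v] C'.
  move=> u w C'u uw Cw; have [->|wv] := eqVneq w v; first by right; rewrite inE.
  left; apply: (component_adj cc C'u); split=> // z [->|->]; split=> //.
  - exact: C'C.
  - by move=> uv; rewrite /= uv in C'u.
  - by move=> /= wv'; rewrite wv' eqxx in wv.
have conC' : connected_graph (induced G C').
  have [C'0 conC'] := comp_of_connected Hd.
  split; first by have [x C'x] := C'0; exists x; split=> //; apply/CG/C'C.
  move=> x y [_ C'x] [_ C'y]; apply: walk_sub (conC' x y C'x C'y).
  split=> [z C'z|e ee]; first by split=> //; exact/CG/C'C.
  split; first by case: ee => -[].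
  by have [a [b [ca cb _ ->]]] := edge_two_subsets ee => z [->|->].
have D'C' : D' `<=` C'.
  have [_ conD' _] := rD'; have [D'G _ _] := rD'.
  have sub : subgraph (induced G D') H.
    have D'CV x : D' x -> C x /\ x <> v.
      by move=> D'x; split; [exact/DC/D'D | move=> xv; rewrite xv in D'x].
    by split=> [x [Gx /D'CV ?]|e [Ge eD']]; split=> // x /eD' /D'CV.
  have [sub' _] := connected_sub_comp_of sub conD' (conj (D'G _ D'd) D'd).
  by move=> x D'x; apply: sub'; split=> //; exact: D'G.
have lC' : large C' by exact: large_sub lD'.
exists C', D'; split; last first.
  split=> // t bD u w D'u uw C'w.
  have [|nD'w] := pselect (D' w); [by left|right].
  have [Dw|//] := bD u w (D'D _ D'u) uw (C'C _ C'w).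
  have [//|] := sepD'.2 u w D'u uw I.
  rewrite mem_cat inE => /orP[/sepD.1//|/eqP wv].
  by rewrite wv in C'w.
split=> //; split=> //.
- split=> //; split=> //; first by move=> x /C'C /CG.
  exists (v :: sC); split.
    by move=> x; rewrite inE => /predU1P[->//|/sepC.1 nCx /C'C].
  move=> u w C'u uw _; rewrite inE.
  have [Cw|ws] := sepC.2 u w (C'C _ C'u) uw I; last by right; rewrite ws orbT.
  by have [|] := bC' u w C'u uw Cw; [left | rewrite inE => ->; right].
- have [u [w [Cu Cw uw C'u nC'w]]] :=
    connected_exit conC CG (C'C _ (D'C' _ D'd)) (D'C' _ D'd) Cv nC'v.
  have [//|] := bC' u w C'u uw Cw.
  by rewrite inE => /eqP wv; exists u => //=; rewrite -wv; exact: adj_sym.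
Qed.

(** Used to see that the rest of a path remains available after one move,
    unless its end has been left behind. *)
Lemma path_in_comp C D v p x : boundary_in G C [:: v] D ->
  path (fun u w => `[< adj G u w >]) x p -> (forall y, y \in x :: p -> C y) ->
  v \notin x :: p -> D (last x p) -> forall y, y \in x :: p -> D y.
Proof.
move=> bD; elim: p x => [|z p IH] x /=.
  by move=> _ _ _ Dx y; rewrite inE => /eqP ->.
move=> /andP[/asboolP xz zp] inC; rewrite inE negb_or => /andP[vx vzp] Dl.
have Dzp : forall y, y \in z :: p -> D y.
  by apply: IH => // y yp; apply: inC; rewrite inE yp orbT.
move=> y; rewrite inE => /predU1P[->|]; last exact: Dzp.
have Dz : D z by apply: Dzp; rewrite mem_head.
have [//|] := bD z x Dz (adj_sym xz) (inC x (mem_head _ _)).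
by rewrite inE eq_sym (negPf vx).
Qed.

Definition stepb : rel (T * set T) := fun x y => `[< step x y >].

(** Walking along a path of [C] towards a boundary vertex [b] of the target,
    the search either loses [b] on the way, because [b] and the target fall in
    different components, or finally visits [b].  In both cases [b] is no
    longer in the current component. *)
Lemma exhaust_vertex p v b C D :
  front (v, C) -> large_region D -> D `<=` C ->
  path (fun u w => `[< adj G u w >]) v p -> uniq p -> last v p = b ->
  p != [::] -> (forall y, y \in p -> C y) ->
  exists q D', [/\ path stepb (v, C) q, large_region D', D' `<=` D,
    D' `<=` (last (v, C) q).2 & ~ (last (v, C) q).2 b] /\
    (front (last (v, C) q) /\
    forall s, boundary_in G C s D -> boundary_in G (last (v, C) q).2 s D').
Proof.
elim: p v C D => // w p IH v C D fC lD DC /=.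
move=> /andP[/asboolP vw wp] /andP[nwp up] lb _ inC.
have Cw : C w by apply: inC; rewrite mem_head.
have [[rC lC] nCv _] := fC.
have [C' [D' [[fC' C'C bC' lD' D'D] [D'C' bD']]]] :=
  delete_vertex rC Cw lD DC.
have sC : step (v, C) (w, C') by [].
have [C'b|nC'b] := pselect (C' b); last first.
  exists [:: (w, C')], D'; split=> //; split=> //=.
  by rewrite andbT; apply/asboolP.
have [_ /= nC'w _] := fC'.
case: p IH wp nwp up lb inC => [|z p] IH wp nwp up lb inC.
  by move: nC'w; rewrite /= in lb; rewrite lb.
have inC' : forall y, y \in z :: p -> C' y.
  move: wp => /= /andP[_ zp].
  apply: (path_in_comp bC' zp) => //.
    by move=> y yp; apply: inC; rewrite inE yp orbT.
  by rewrite /= in lb; rewrite lb.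
have [q [D2 [[qp lD2 D2D D2C nb] [f2 b2]]]] :=
  IH w C' D' fC' lD' D'C' wp up lb isT inC'.
exists ((w, C') :: q), D2; split.
  by split=> //=; [apply/andP; split=> //; apply/asboolP | move=> x /D2D/D'D].
by split=> // s /bD' /b2.
Qed.

(** Once all boundary vertices of the target have been left behind, the current
    component equals what remains of the target. *)
Lemma descend s v C D :
  front (v, C) -> large_region D -> D `<=` C -> boundary_in G C s D ->
  exists q, [/\ path stepb (v, C) q, front (last (v, C) q) &
    (last (v, C) q).2 `<=` D].
Proof.
elim: s v C D => [|b s IH] v C D fC lD DC bD.
  have [[[CG conC _] _] _ _] := fC.
  exists [::]; split=> //=; rewrite (connected_absorb conC CG DC _ bD) //.
  exact: region_nonempty lD.1.
have [Cb|nCb] := pselect (C b); last first.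
  apply: (IH v C D) => // u w Du uw Cw.
  have [|] := bD u w Du uw Cw; first by left.
  rewrite inE => /predU1P[wb|]; last by right.
  by rewrite wb in Cw.
have [[[CG [_ conC] _] _] nCv [a /= Ca va]] := fC.
have [p pp lp] := conC a b (conj (CG _ Ca) Ca) (conj (CG _ Cb) Cb).
move: lp; case/shortenP: pp => {}p pp up _ lp.
have inC y : y \in a :: p -> C y.
  elim: p a Ca {va up lp} pp => [|z p IHp] a Ca /=.
    by move=> _; rewrite inE => /eqP ->.
  move=> /andP[/asboolP [_ sC] zp]; rewrite inE => /predU1P[->//|].
  by apply: IHp zp; apply: sC; right.
have vp : path (fun u w => `[< adj G u w >]) v (a :: p).
  apply/andP; split; first exact/asboolP.
  by apply: sub_path pp => u w /asboolP [uw _]; apply/asboolP.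
have [q [D' [[qp lD' D'D D'C nb] [f' b']]]] :=
  exhaust_vertex fC lD DC vp up lp isT inC.
case El : (last (v, C) q) => [v' C'] in D'C nb f' b'.
have [|q' [qp' f2 sub]] := IH v' C' D' f' lD' D'C.
  move=> u w D'u uw C'w.
  have [|] := b' _ bD u w D'u uw C'w; first by left.
  rewrite inE => /predU1P[wb|]; last by right.
  by rewrite wb in C'w.
exists (q ++ q'); rewrite cat_path last_cat El; split=> //; first by rewrite qp.
by move=> x /sub /D'D.
Qed.

(** Any large region found afterwards properly inside [x.2], by whatever means,
    bounds the size of [s]; the end of the ray will provide such regions. *)
Definition jump (x y : T * set T) := exists D s,
  [/\ y.2 `<=` D, D `<=` x.2, separates G s D &
      forall E s', large_region E -> separates G s' E ->
        E `<=` x.2 -> E <> x.2 -> size s <= size s'].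

(** A large proper subregion exists because a vertex can be deleted. *)
Lemma jump_exists x : front x ->
  exists q, [/\ path stepb x q, q <> [::], front (last x q) &
    jump x (last x q)].
Proof.
case: x => v C fx; have /= [[[CG conC [sC sepC]] lC] nCv _] := fx.
pose P n := `[< exists E s, [/\ large_region E, separates G s E, E `<=` C,
  E <> C & size s = n] >].
have exP : exists n, P n.
  have [[a [_ Ca]] _] := conC.
  have [E [EC rE sepE lE]] := large_split [:: a] CG sepC lC.
  exists (size (sC ++ [:: a])); apply/asboolP.
  exists E, (sC ++ [:: a]); split=> //.
  move=> EX; apply: (sepE.1 a); first by rewrite mem_cat inE eqxx orbT.
  by rewrite EX.
case: (ex_minnP exP) => n /asboolP [D [s [lD sepD DC nDC ss]]] min.
have bD : boundary_in G C s D.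
  by move=> u w Du uw _; exact: (sepD.2 u w Du uw I).
have [q [qp fq sub]] := descend fx lD DC bD.
exists q; split=> //.
  by move=> q0; apply: nDC; apply/seteqP; split=> //; rewrite q0 in sub.
exists D, s; split=> // E s' lE sepE EC nEC.
by rewrite ss; apply: min; apply/asboolP; exists E, s'.
Qed.

End large_regions.

(** * Concatenating finite chains *)

(** The state of the recursion is a point with the rest of a planned path; when
    the plan is used up, a new one is made. *)
Lemma concat_paths (S : Type) (R : rel S) (J : S -> S -> Prop) (I : set S) x0 :
  I x0 ->
  (forall x, I x -> exists q, [/\ path R x q, q <> [::], I (last x q) &
    J x (last x q)]) ->
  exists f : nat -> S, [/\ f 0 = x0, forall n, R (f n) (f n.+1) &
    forall N, exists i j, N <= i /\ J (f i) (f j)].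
Proof.
move=> I0 ex.
have ex' x : exists q, I x ->
    [/\ path R x q, q <> [::], I (last x q) & J x (last x q)].
  by have [/ex[q qP]|nI] := pselect (I x); [exists q | exists [::]].
have [plan planP] := choice ex'.
pose next (c : S * seq S) := let q := if c.2 is [::] then plan c.1 else c.2 in
  (head c.1 q, behead q).
pose g n := iter n next (x0, [::]).
have gS n : g n.+1 = next (g n) by [].
have gP n : path R (g n).1 (g n).2 /\ I (last (g n).1 (g n).2).
  elim: n => [|n]; first by [].
  rewrite gS; case: (g n) => x [|y q] /= [].
    by move=> _ /planP []; case: (plan x) => //= y q /andP[].
  by move=> /andP[].
have gstep n : R (g n).1 (g n.+1).1.
  rewrite gS; case: (g n) (gP n) => x [|y q] /= [].
    by move=> _ /planP []; case: (plan x) => //= y q /andP[].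
  by move=> /andP[].
have run n x q : g n = (x, q) -> g (n + size q) = (last x q, [::]).
  elim: q n x => [|y q IH] n x gn; first by rewrite addn0.
  by rewrite /= addnS -addSn; apply: IH; rewrite gS gn.
exists (fun n => (g n).1); split=> // N.
case gN : (g N) => [x q]; have gi := run N x q gN.
have [_] := gP (N + size q); rewrite gi /= => /planP [].
set y := last x q; case E : (plan y) => [//|z p] _ _ _ Jy.
exists (N + size q), ((N + size q).+1 + size p); split; first exact: leq_addr.
have gi1 : g (N + size q).+1 = (z, p) by rewrite gS gi /next /= -/y E.
by rewrite (run _ z p gi1) gi.
Qed.

(** * The end reached by the descent *)

Section cover.
Variables (T : choiceType) (G : graph T) (O : set (set (end_space G))).

Hypothesis open_O : forall U, O U -> end_open U.
Hypothesis cover_O : forall e, exists2 U, O U & U e.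

Hypothesis countable_comps : forall F : set T, finite_set F -> F `<=` vert G ->
  countable [set C : graph T |
    is_component (delete G F) C /\ exists r : nat -> T, is_ray C r].

Variable f : nat -> T * set T.
Hypothesis f0 : front O (f 0) /\ separates G [:: (f 0).1] (f 0).2.
Hypothesis fstep : forall n, step O (f n) (f n.+1).
Hypothesis fjump : forall N, exists i j, N <= i /\ jump O (f i) (f j).

Let v n := (f n).1.
Let C n := (f n).2.

Lemma descent_front n : front O (f n).
Proof. by case: n => [|n]; [exact: f0.1 | case: (fstep n)]. Qed.

Lemma descent_anti i j : i <= j -> C j `<=` C i.
Proof.
move=> /subnKC <-; elim: (j - i)%N => [|k IH]; first by rewrite addn0.
rewrite addnS => x Cx; apply: IH.
by have [_ _ _ sub _] := fstep (i + k); exact: sub.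
Qed.

Lemma descent_mem i j : i < j -> C i (v j).
Proof.
by case: j => // j ij; apply: (descent_anti (j := j)) => //; case: (fstep j).
Qed.

Lemma descent_notin i j : i <= j -> ~ C j (v i).
Proof. by move=> ij /(descent_anti ij); case: (descent_front i). Qed.

Lemma descent_vert n : C n `<=` vert G.
Proof. by case: (descent_front n) => -[[]]. Qed.

Lemma descent_connected n : connected_graph (induced G (C n)).
Proof. by case: (descent_front n) => -[[]]. Qed.

Lemma descent_ray : is_ray G v.
Proof.
split=> [i j vij|n|n]; last by have [] := fstep n.
  case: (ltngtP i j) => // /descent_mem Cv.
    by case: (descent_notin (leqnn i)); rewrite vij.
  by case: (descent_notin (leqnn j)); rewrite -vij.
by have [_ vv _ _ _] := fstep n; case: (adj_vert vv).
Qed.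

Lemma descent_separates n : separates G [seq v i | i <- iota 0 n.+1] (C n).
Proof.
split=> [x /mapP[i]|].
  by rewrite mem_iota add0n ltnS => /andP[_ ?] ->; exact: descent_notin.
elim: n => [|n IH] u w Cu uw _; first exact: (f0.2.2 u w Cu uw I).
have [_ _ _ CC bC] := fstep n.
rewrite -(addn1 n.+1) iotaD map_cat mem_cat.
have [Cw|->] := IH u w (CC _ Cu) uw I; last by right.
have [|] := bC u w Cu uw Cw; first by left.
by rewrite inE => /eqP ->; right; rewrite /= inE eqxx orbT.
Qed.


Lemma descent_escape (l : seq T) : (forall q, q \in l -> exists n, ~ C n q) ->
  exists N, forall q, q \in l -> ~ C N q.
Proof.
elim: l => [|q l IH] out; first by exists 0.
have [N NP] : exists N, forall q, q \in l -> ~ C N q.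
  by apply: IH => q' q'l; apply: out; rewrite inE q'l orbT.
have [n nq] := out q (mem_head _ _).
exists (maxn n N) => q'; rewrite inE => /predU1P[->|/NP nq'].
  by move=> /(descent_anti (leq_maxl _ _)).
by move=> /(descent_anti (leq_maxr _ _)).
Qed.

(** A vertex outside the intersection [K] of all [C n] but adjacent to [K] lies
    on the boundary of every sufficiently small [D]; when [K] is nonempty, there
    are infinitely many such vertices, as there is one in each [C N]. *)
Lemma small_boundary_meet_empty p :
  (forall N, exists D s, [/\ D `<=` C N, (exists j, C j `<=` D),
     separates G s D & size s <= p]) ->
  forall x, exists n, ~ C n x.
Proof.
move=> smallD x; apply: contrapT => nex.
have Kx n : C n x by apply: contrapT => nCx; apply: nex; exists n.
have many k : exists l, [/\ uniq l, size l = k & forall q, q \in l ->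
    (exists n, ~ C n q) /\ exists u, (forall n, C n u) /\ adj G u q].
  elim: k => [|k [l [ul sl lP]]]; first by exists [::].
  have [N NP] := descent_escape (fun q ql => (lP q ql).1).
  (* [C N] contains [x], which is in [K], and [v N.+1], which is not. *)
  have [u [q [Cu Cq uq Ku nKq]]] := connected_exit (P := \bigcap_n C n)
    (descent_connected N) (@descent_vert N) (Kx N) (fun n _ => Kx n)
    (descent_mem (ltnSn N)) (fun K => descent_notin (leqnn N.+1) (K N.+1 I)).
  exists (q :: l); split=> /=; [|by rewrite sl|].
    by rewrite ul andbT; apply/negP => /NP.
  move=> q'; rewrite inE => /predU1P[->|/lP//]; split.
    apply: contrapT => nn; apply: nKq => n _; apply: contrapT => nC.
    by apply: nn; exists n.
  by exists u; split=> // n; exact: Ku.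
have [l [ul sl lP]] := many p.+1.
have [N NP] := descent_escape (fun q ql => (lP q ql).1).
have [D [s [DN [j jD] [_ sD] sp]]] := smallD N.
have : size l <= size s.
  apply: uniq_leq_size => // q ql; have [_ [u [Ku uq]]] := lP q ql.
  by have [/DN/(NP q ql)|] := sD u q (jD _ (Ku j)) uq I.
by move=> /leq_trans /(_ sp); rewrite sl ltnn.
Qed.

(** The end of the ray [v] lies in a member [U] of the cover, which then covers
    all ends in some [C n]. *)
Lemma no_descent : False.
Proof.
have [e er] := end_of_ray descent_ray.
have [U OU Ue] := cover_O e.
have [F [finF FG FU]] := open_O OU Ue.
have [cE /(_ _ er) [m [_ rE _]]] := end_compP e finF FG.
set E := end_comp e F in cE rE.
have [[EH _] _ _] := cE.
have EF x : vert E x -> ~ F x by move=> /EH [].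
have vE i : m <= i -> vert E (v i) by move=> /subnKC <-; exact: rE.
have notin D : D `<=` vert E -> ~ large O D.
  exact: not_large_in_nbhd OU finF FG FU.
have absorb D x : connected_graph (induced G D) -> D `<=` vert G ->
    (forall y, D y -> ~ F y) -> D x -> vert E x -> D `<=` vert E.
  move=> conD DG DF Dx Ex y Dy; apply: contrapT => nEy.
  have [u [w [Du Dw uw Eu]]] := connected_exit conD DG Dx Ex Dy nEy.
  by apply; apply: (component_adj cE Eu); apply: adj_delete => //; exact: DF.
have [sF FE] := (finite_seqP F).1 finF.
(* The bound on boundaries of large regions deep in the descent. *)
pose p := size ([seq v i | i <- iota 0 m] ++ sF).
have small n : m <= n -> exists D s, [/\ large_region O D, separates G s D,
    D `<=` C n, D <> C n & size s = p].
  move=> mn.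
  have lC : large O (C n) by case: (descent_front n) => -[].
  have [D [DC rD sepD lD]] :=
    large_split countable_comps sF (@descent_vert n) (descent_separates n) lC.
  have DF y : D y -> ~ F y.
    move=> Dy; rewrite FE => /= ys.
    by apply: (sepD.1 y) => //; rewrite mem_cat ys orbT.
  have DE y : D y -> ~ vert E y.
    move=> Dy Ey; apply: (notin D) => //; have [DG conD _] := rD.
    exact: absorb conD DG DF Dy Ey.
  exists D, ([seq v i | i <- iota 0 m] ++ sF); split=> //.
  - split=> [x|u w Du uw _].
      rewrite mem_cat => /orP[/mapP[i]|xs Dx]; last first.
        by apply: (DF x) => //; rewrite FE.
      rewrite mem_iota add0n => /andP[_ im] -> /DC.
      by apply: descent_notin; apply: leq_trans (ltnW im) mn.
    have [Dw|] := sepD.2 u w Du uw I; first by left.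
    rewrite !mem_cat => /orP[/mapP[i _ wi]|->]; last by right; rewrite orbT.
    right; apply/orP; left; rewrite wi map_f // mem_iota add0n /= ltnNge.
    apply/negP => mi; apply: (DE u) => //.
    apply: (component_adj cE (vE i mi)).
    apply: adj_delete => //; last exact: DF.
      by apply: adj_sym; rewrite -wi.
    exact/EF/vE.
  - move=> DCn; apply: (DE (v n.+1)); last by apply/vE/leqW.
    by rewrite DCn; exact: descent_mem.
have empty x : exists n, ~ C n x.
  apply: (@small_boundary_meet_empty p) => N.
  have [i [j [Ni [D [s [jD Di sepD mins]]]]]] := fjump (maxn m N).
  have [D' [s' [lD' sepD' D'C nD' <-]]] :=
    small i (leq_trans (leq_maxl _ _) Ni).
  exists D, s; split=> //; last exact: mins lD' sepD' D'C nD'.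
    by move=> y /Di; apply: descent_anti; exact: leq_trans (leq_maxr _ _) Ni.
  by exists j.
have [n nF] := descent_escape (fun x (_ : x \in sF) => empty x).
have [_ lC] : large_region O (C (maxn m n)).
  by case: (descent_front (maxn m n)).
apply: notin lC.
apply: (absorb _ (v (maxn m n).+1)).
- exact: descent_connected.
- exact: descent_vert.
- by rewrite FE => y /(descent_anti (leq_maxr _ _)) Cy /nF.
- exact: descent_mem.
- by apply: vE; exact: leqW (leq_maxl _ _).
Qed.
End cover.

(** * The characterization *)

Lemma countable_components_lindelof (T : choiceType) (G : graph T) :
  (forall F : set T, finite_set F -> F `<=` vert G ->
    countable [set C : graph T |
      is_component (delete G F) C /\ exists r : nat -> T, is_ray C r]) ->
  lindelof (end_space G).
Proof.
move=> cc O oO covO.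
have cover_O e : exists2 U, O U & U e.
  by have [U OU Ue] : (\bigcup_(U in O) U) e by [rewrite covO]; exists U.
have open_O U : O U -> end_open U by move=> /oO; rewrite end_openE.
suff : ~ large O (vert G).
  move=> /contrapT [O' O'O [cO' sub]]; exists O' => //; split=> //.
  apply/seteqP; split=> // e _; apply: sub.
  have [r er] := rays_of_nonempty e; exists r => //.
  by case: (rays_of_rayP er).
move=> lG.
have sepG : separates G [::] (vert G).
  by split=> // u w _ uw _; left; case: (adj_vert uw).
have [D [_ rD sepD lD]] := large_split cc [::] (fun x Gx => Gx) sepG lG.
have [x Dx] := region_nonempty rD.
have [C [_ [[fC CD bC _ _] _]]] :=
  delete_vertex cc rD Dx (conj rD lD) (fun y Dy => Dy).
have sepC : separates G [:: x] C.
  split=> [y|u w Cu uw _]; first by rewrite inE => /eqP ->; case: fC.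
  by have [Dw|//] := sepD.2 u w (CD _ Cu) uw I; exact: bC Cu uw Dw.
have [f [f0 fstep fjump]] := concat_paths fC (jump_exists cc).
apply: (no_descent open_O cover_O cc (f := f)) => //.
- by rewrite f0.
- by move=> n; exact/asboolP/fstep.
Qed.

Theorem theorem2p2 (T : Type) (G : graph T) :
  lindelof (end_space G) <->
  (forall F : set T, finite_set F -> F `<=` vert G ->
    countable [set C : graph T |
      is_component (delete G F) C /\ exists r : nat -> T, is_ray C r]).
Proof.
split=> [linG F finF FG|]; first exact: lindelof_countable_components.
exact: (@countable_components_lindelof {classic T} G).
Qed.
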